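(* Let $E_1,E_2,\dots$ and $U_1,U_2,\dots$ be two independent sequences of independent random variables, where each $E_i$ is exponentially distributed with rate one and each $U_i$ is uniformly distributed on $[0,1]$. Then for every $n=1,2,\dots$ $$\left(\frac{E_1}{U_1}+\frac{E_2}{U_1U_2}+\cdots+\frac{E_n}{U_1\cdots U_n}\right)\left(1-U_1\cdots U_{n+1}\right)\stackrel{d}{=}\left(E_1+\frac{E_2}{U_1}+\cdots+\frac{E_{n+1}}{U_1\cdots U_n}\right)\left(1-U_1\cdots U_n\right).$$
   Context: $\stackrel{d}{=}$ denotes equality in distribution of real-valued random variables. *)

(* Defs.v *)
From mathcomp Require Export all_boot all_order all_algebra.
From mathcomp Require Export finmap.
From mathcomp Require Export all_classical all_reals all_analysis.

Set Implicit Arguments.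
Unset Strict Implicit.
Unset Printing Implicit Defensive.

Import Order.TTheory GRing.Theory Num.Theory.

Local Open Scope classical_set_scope.
Local Open Scope ring_scope.

Section independence.
Local Open Scope ereal_scope.
Context d d' (T : measurableType d) (T' : measurableType d') (R : realType).
Variable P : probability T R.

(* sigma(X_i, i : I) *)
Definition sigma_RVs (I : Type) (X : I -> {RV P >-> T'}) : set_system T :=
  <<s \bigcup_i preimage_set_system setT (X i) measurable >>.

(* Mutual independence: the product rule on every finite subfamily. *)
Definition mutually_independent_RVs (I : choiceType)
    (X : I -> {RV P >-> T'}) : Prop :=
  forall (J : {fset I}) (B : I -> set T'),
    (forall i, measurable (B i)) ->
    P (\bigcap_(i in [set` J]) X i @^-1` B i)
    = \prod_(i <- J) P (X i @^-1` B i).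

(* Independence of two families, each taken as a whole: it is silent about
   the dependence inside each family. *)
Definition independent_families (I J : Type)
    (X : I -> {RV P >-> T'}) (Y : J -> {RV P >-> T'}) : Prop :=
  forall A B, sigma_RVs X A -> sigma_RVs Y B -> P (A `&` B) = P A * P B.

(* X and Y are T'-valued random variables with the same law; they are given as
   plain functions so that the law can be stated for explicit formulas. *)
Definition eq_in_distribution (X Y : T -> T') : Prop :=
  [/\ measurable_fun setT X, measurable_fun setT Y &
   forall A, measurable A -> pushforward P X A = pushforward P Y A].

End independence.

Section laws.
Context d (T : measurableType d) (R : realType) (P : probability T R).

Definition exponentially_distributed (rate : R) (X : {RV P >-> R}) : Prop :=
  forall A, measurable A -> distribution P X A = exponential_prob rate A.

Definition uniformly_distributed (a b : R) (ab : a < b)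
    (X : {RV P >-> R}) : Prop :=
  forall A, measurable A -> distribution P X A = uniform_prob ab A.

End laws.

(* Main.v *)
Require Import Defs.
From HB Require Import structures.
From mathcomp Require Import ring lra measurable_realfun.

Set Implicit Arguments.
Unset Strict Implicit.
Unset Printing Implicit Defensive.

Import Order.TTheory GRing.Theory Num.Theory.
Import numFieldNormedType.Exports.

Local Open Scope classical_set_scope.
Local Open Scope ring_scope.

(** Put V_n = U_1 ... U_n and S_n = E_1 / V_1 + ... + E_n / V_n.  The left-hand
    side is S_n (1 - V_n U_{n+1}).  The right-hand side is
    (E_1 + S'_n) (1 - V_n), where S'_n is built like S_n from E_2, E_3, ...; so
    (S'_n, V_n) has the law of (S_n, V_n), and E_1 is independent of it.
    Averaging over the one variable that does not enter the pair, both sides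
    become functions of (S_n, V_n): [lhs_mean] and [rhs_mean].

    The pair (S_n, V_n) is a Markov chain.  Let Z_n = S_n (1 - V_n).  Given
    Z_n = z, the law of V_n is the same for all n > 0: it is proportional to
    the measure

      K_z(dv) = v / (1 - v) * exp (- z v / (1 - v)) dv   on (0, 1).

    Hence the expectation of phi (S_n, V_n) depends on phi only through the
    function z |-> [cond_mean phi z], the K_z-integral of
    phi (z / (1 - v), v).  The proof compares two functions phi and psi with
    the same conditional means, by induction on n.  For n = 1 the expectation
    of phi is the integral of [cond_mean phi] over (0, +oo) ([advance_start]).
    For the step, if [advance phi] is the conditional expectation of phi one
    step later, then [cond_mean (advance phi)] is an integral transform of
    [cond_mean phi] ([cond_mean_advance]): the chain intertwines with an
    autonomous evolution of Z.  This follows from Tonelli's theorem and affine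
    substitutions, the point being that the density of the new v' factors out
    of the integral over the old v ([integral_joint_weight]).

    It remains to compare the conditional means of [lhs_mean] and [rhs_mean].
    Affine substitutions bring both to an integral of
    f (z') exp (z - z') / z' over z' > z, with respective factors

      int_0^1 exp (- z' v / (1 - v)) dv   and
      int_0^1 z' v / (1 - v)^2 * exp (- z' v / (1 - v)) dv,

    which are equal by an integration by parts
    ([odds_exponential_balance]). *)

(** * Lebesgue integrals of nonnegative functions *)

Section affine.
Context {R : realType}.
Local Notation mu := (@lebesgue_measure R).
Local Notation mR := (measurableTypeR R).

(** Away from 0 the inverse is, up to sign, the power function of exponent
    -1, which is known to be measurable. *)
Lemma measurable_invr : measurable_fun [set: R] (fun x : R => x^-1).
Proof.
have -> : (fun x : R => x^-1) =
    (fun x => if 0 <= x then x `^ (-1) else - ((- x) `^ (-1))).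
  apply/funext => x; case: ifPn => [x0|]; first by rewrite powR_inv1.
  by rewrite -ltNge => x0; rewrite powR_inv1 ?oppr_ge0 ?ltW// invrN opprK.
apply: measurable_fun_ifT; first exact: measurable_fun_ler.
  exact: measurable_powR.
apply: measurableT_comp => //.
exact: (measurableT_comp (@measurable_powR R (-1))).
Qed.

Lemma measurable_affine (c e : R) :
  measurable_fun [set: mR] (fun x : mR => (c * x + e : mR)).
Proof. by apply: measurable_funD => //; exact: measurable_funM. Qed.

(** By uniqueness of Lebesgue measure, it suffices to look at half-open
    intervals; the sign of c decides on which side the preimage is open. *)
Lemma lebesgue_measure_affine (c e : R) (A : set mR) : c != 0 -> measurable A ->
  mu A = (`|c|%:E * mu ((fun x : mR => (c * x + e)%R : mR) @^-1` A))%E.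
Proof.
move=> c0 mA.
pose m := mscale (NngNum (normr_ge0 c))
  (pushforward mu (fun x : mR => (c * x + e : mR))).
have mm := measurable_affine c e.
transitivity (m mm A) => //; apply: lebesgue_measure_unique => // _ [[a b]] _ <-.
rewrite -[RHS]/(`|c|%:E * mu ((fun x : mR => (c * x + e)%R : mR) @^-1`
  `]a, b]%classic))%E.
rewrite lebesgue_measure_itv/= lte_fin.
case: (ltgtP c 0) c0 => // c0 _.
- have -> : (fun x : mR => c * x + e) @^-1` `]a, b]%classic =
      `[(b - e) / c, (a - e) / c[%classic.
    apply/seteqP; split => x /=; rewrite !in_itv/=;
      rewrite ler_ndivrMr// ltr_ndivlMr// lerBrDr ltrBlDr ![_ * c]mulrC;
      by rewrite andbC.
  rewrite lebesgue_measure_itv/= lte_fin ltr_nM2r ?invr_lt0// ltrD2r.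
  case: ifPn => ab; last by rewrite mule0.
  by rewrite ltr0_norm// -!EFinD -EFinM; congr EFin; field; rewrite lt_eqF.
- have -> : (fun x : mR => c * x + e) @^-1` `]a, b]%classic =
      `](a - e) / c, (b - e) / c]%classic.
    apply/seteqP; split => x /=; rewrite !in_itv/=;
      by rewrite ler_pdivlMr// ltr_pdivrMr// lerBrDr ltrBlDr ![_ * c]mulrC.
  rewrite lebesgue_measure_itv/= lte_fin ltr_pM2r ?invr_gt0// ltrD2r.
  case: ifPn => ab; last by rewrite mule0.
  by rewrite gtr0_norm// -!EFinD -EFinM; congr EFin; field; rewrite gt_eqF.
Qed.

Lemma ge0_integral_affine (c e : R) (f : mR -> \bar R) : c != 0 ->
  measurable_fun setT f -> (forall x, 0 <= f x)%E ->
  (\int[mu]_x f x = `|c|%:E * \int[mu]_x f (c * x + e)%R)%E.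
Proof.
move=> c0 mf f0.
have mm := measurable_affine c e.
pose m := mscale (NngNum (normr_ge0 c))
  (pushforward mu (fun x : mR => (c * x + e : mR))).
transitivity (\int[m mm]_x f x)%E.
  by apply: eq_measure_integral => A mA _; exact: lebesgue_measure_affine.
by rewrite ge0_integral_mscale//= ge0_integral_pushforward.
Qed.

End affine.

Section density.
Context d (T : measurableType d) (R : realType).
Variables (nu : {finite_measure set T -> \bar R})
          (mu : {sigma_finite_measure set T -> \bar R}) (p : T -> R).
Hypotheses (mp : measurable_fun setT p) (p0 : forall x, 0 <= p x).
Hypothesis nuE : forall A, measurable A -> nu A = (\int[mu]_(x in A) (p x)%:E)%E.

(** The Radon-Nikodym derivative of nu is almost everywhere equal to p, and the
    change of variables is known for the derivative. *)
Lemma ge0_integral_density (f : T -> \bar R) :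
  measurable_fun setT f -> (forall x, 0 <= f x)%E ->
  (\int[nu]_x f x = \int[mu]_x ((p x)%:E * f x))%E.
Proof.
move=> mf f0.
have mpE : measurable_fun setT (EFin \o p) by exact/measurable_EFinP.
have dom : nu `<< mu.
  apply/null_content_dominatesP => A mA muA0; rewrite nuE//.
  by apply: null_set_integral => //; exact: measurable_funTS.
rewrite -(Radon_Nikodym_SigmaFinite.change_of_variables dom)//.
have RNi := Radon_Nikodym_SigmaFinite.f_integrable dom.
apply: ge0_ae_eq_integral => //.
- by apply: emeasurable_funM => //; exact: measurable_int RNi.
- exact: emeasurable_funM.
- by move=> x _; rewrite mule_ge0// Radon_Nikodym_SigmaFinite.f_ge0.
- by move=> x _; rewrite mule_ge0// lee_fin.
under [X in ae_eq _ _ _ X]eq_fun do rewrite muleC.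
apply: ae_eqe_mul2l => /=.
apply: integral_ae_eq => //.
by move=> A _ mA; rewrite -Radon_Nikodym_SigmaFinite.f_integral// nuE.
Qed.

End density.

Section measurability.
Context d (T : measurableType d) d1 (A : measurableType d1)
  d2 (B : measurableType d2) {R : realType}.
Local Notation mR := (measurableTypeR R).
Local Notation mf := (measurable_fun [set: _]).

(** These restate the closure properties of measurability in the applied form
    in which integrands are written, so that the tactic [meas] below can choose
    the rule from the head symbol. *)
Lemma meas_fst (f : T -> A * B) : mf f -> mf (fun x => (f x).1).
Proof. exact: measurableT_comp measurable_fst. Qed.

Lemma meas_snd (f : T -> A * B) : mf f -> mf (fun x => (f x).2).
Proof. exact: measurableT_comp measurable_snd. Qed.

Lemma meas_pair (f : T -> A) (g : T -> B) : mf f -> mf g ->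
  mf (fun x => (f x, g x)).
Proof. exact: measurable_fun_pair. Qed.

Lemma meas_comp (h : A -> B) : mf h ->
  forall f : T -> A, mf f -> mf (fun x => h (f x)).
Proof. by move=> mh f; exact: measurableT_comp. Qed.

Lemma meas_if (b : T -> bool) (f g : T -> A) : mf b -> mf f -> mf g ->
  mf (fun x => if b x then f x else g x).
Proof. exact: measurable_fun_ifT. Qed.

Lemma meas_and (b c : T -> bool) : mf b -> mf c -> mf (fun x => b x && c x).
Proof. exact: measurable_and. Qed.

Lemma meas_lt (f g : T -> mR) : mf f -> mf g -> mf (fun x => f x < g x).
Proof. exact: measurable_fun_ltr. Qed.

Lemma meas_add (f g : T -> mR) : mf f -> mf g -> mf (fun x => f x + g x : mR).
Proof. exact: measurable_funD. Qed.

Lemma meas_mul (f g : T -> mR) : mf f -> mf g -> mf (fun x => f x * g x : mR).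
Proof. exact: measurable_funM. Qed.

Lemma meas_opp (f : T -> mR) : mf f -> mf (fun x => - f x : mR).
Proof. by move=> ?; exact: measurableT_comp. Qed.

Lemma meas_inv (f : T -> mR) : mf f -> mf (fun x => (f x)^-1 : mR).
Proof. exact: (measurableT_comp (@measurable_invr R)). Qed.

Lemma meas_expR (f : T -> mR) : mf f -> mf (fun x => expR (f x) : mR).
Proof. by move=> ?; exact: measurableT_comp. Qed.

Lemma meas_exp (f : T -> mR) n : mf f -> mf (fun x => f x ^+ n : mR).
Proof. exact: measurable_funX. Qed.

Lemma meas_EFin (f : T -> mR) : mf f -> mf (fun x => (f x)%:E).
Proof. by move/measurable_EFinP. Qed.

Lemma meas_emul (f g : T -> \bar R) : mf f -> mf g ->
  mf (fun x => f x * g x)%E.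
Proof. exact: emeasurable_funM. Qed.

Lemma meas_integral (f : T -> mR -> \bar R) :
  mf (fun p : T * mR => f p.1 p.2) -> (forall x y, 0 <= f x y)%E ->
  mf (fun x => \int[@lebesgue_measure R]_y f x y)%E.
Proof.
move=> mF f0.
by apply: (measurable_fun_fubini_tonelli_F (m2 := @lebesgue_measure R)
  (fun p : T * mR => f p.1 p.2)).
Qed.

End measurability.

(* The patterns without a binder are for partial applications, which
   eta-reduction leaves after unification.  Conditionals come last because no
   pattern can describe one whose branches depend on the bound variable. *)
Ltac meas_step := lazymatch goal with
  | |- measurable_fun _ (fun x => x) => exact: measurable_id
  | |- measurable_fun _ (fun x => EFin (@?f1 x)) => apply: meas_EFin
  | |- measurable_fun _ (fun x => andb (@?f1 x) (@?f2 x)) => apply: meas_and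
  | |- measurable_fun _ (fun x => Order.lt (@?f1 x) (@?f2 x)) => apply: meas_lt
  | |- measurable_fun _ (fun x => expR (@?f1 x)) => apply: meas_expR
  | |- measurable_fun _ (fun x => GRing.inv (@?f1 x)) => apply: meas_inv
  | |- measurable_fun _ (fun x => GRing.mul (@?f1 x) (@?f2 x)) => apply: meas_mul
  | |- measurable_fun _ (fun x => GRing.exp (@?f1 x) _) => apply: meas_exp
  | |- measurable_fun _ (fun x => GRing.opp (@?f1 x)) => apply: meas_opp
  | |- measurable_fun _ (fun x => GRing.add (@?f1 x) (@?f2 x)) => apply: meas_add
  | |- measurable_fun _ (fun x => mule (@?f1 x) (@?f2 x)) => apply: meas_emul
  | |- measurable_fun _ (fun x => pair (@?f1 x) (@?f2 x)) => apply: meas_pair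
  | |- measurable_fun _ (fun x => fst (@?f1 x)) => apply: meas_fst
  | |- measurable_fun _ (fun x => snd (@?f1 x)) => apply: meas_snd
  | |- measurable_fun _ (EFin) => apply: meas_EFin
  | |- measurable_fun _ (Order.lt _) => apply: meas_lt
  | |- measurable_fun _ (expR) => apply: meas_expR
  | |- measurable_fun _ (GRing.inv) => apply: meas_inv
  | |- measurable_fun _ (GRing.mul _) => apply: meas_mul
  | |- measurable_fun _ (GRing.opp) => apply: meas_opp
  | |- measurable_fun _ (GRing.add _) => apply: meas_add
  | |- measurable_fun _ (mule _) => apply: meas_emul
  | |- measurable_fun _ (pair _) => apply: meas_pair
  | |- measurable_fun _ (fst) => apply: meas_fst
  | |- measurable_fun _ (snd) => apply: meas_snd
  | H : measurable_fun _ ?h |- measurable_fun _ ?h => exact: H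
  | H : measurable_fun _ ?h |- measurable_fun _ (fun x => ?h (@?f1 x)) =>
      apply: (meas_comp H)
  | |- _ => first [exact: measurable_cst | apply: meas_if]
  end.
Ltac meas := repeat meas_step.

(** * The Markov step and the conditional mean *)

Section kernels.
Context {R : realType}.
Local Notation mu := (@lebesgue_measure R).
Local Notation mR := (measurableTypeR R).
Implicit Types (phi psi : mR * mR -> \bar R) (z v u e s : R).

(** Densities vanish outside open sets, so that all integrals below range over
    the whole line and substitutions need no care of the domain. *)
Definition unif01_pdf u : R := if (0 < u) && (u < 1) then 1 else 0.
Definition exp1_pdf e : R := if 0 < e then expR (- e) else 0.

(** The measure K_z, with s = z / (1 - v) the value of S that goes with v. *)
Definition cond_density z v : R :=
  if (0 < v) && (v < 1) then v / (1 - v) * expR (- (z * (v / (1 - v)))) else 0.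

Definition cond_mean phi z : \bar R :=
  (\int[mu]_v ((cond_density z v)%:E * phi ((z / (1 - v))%R, v)))%E.

(** From (s, v), the chain moves to (s + e / (v u), v u). *)
Definition advance phi (x : mR * mR) : \bar R :=
  (\int[mu]_u ((unif01_pdf u)%:E *
    \int[mu]_e ((exp1_pdf e)%:E * phi ((x.1 + e / (x.2 * u))%R, (x.2 * u)%R))))%E.

Lemma unif01_pdf_ge0 u : 0 <= unif01_pdf u.
Proof. by rewrite /unif01_pdf; case: ifP. Qed.

Lemma exp1_pdf_ge0 e : 0 <= exp1_pdf e.
Proof. by rewrite /exp1_pdf; case: ifP => // _; exact: expR_ge0. Qed.

Lemma cond_density_ge0 z v : 0 <= cond_density z v.
Proof.
rewrite /cond_density; case: ifP => // /andP[v0 v1].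
by rewrite mulr_ge0 ?expR_ge0// divr_ge0 ?subr_ge0 ?ltW.
Qed.

Lemma measurable_unif01_pdf : measurable_fun [set: mR] (unif01_pdf : mR -> mR).
Proof. rewrite /unif01_pdf; meas. Qed.

Lemma measurable_exp1_pdf : measurable_fun [set: mR] (exp1_pdf : mR -> mR).
Proof. rewrite /exp1_pdf; meas. Qed.

Lemma measurable_advance phi : measurable_fun setT phi -> (forall x, 0 <= phi x)%E ->
  measurable_fun setT (advance phi).
Proof.
move=> mphi phi0; have m1 := measurable_unif01_pdf; have m2 := measurable_exp1_pdf.
rewrite /advance; apply: meas_integral.
  apply: meas_emul; first by meas.
  apply: meas_integral; first by meas.
  by move=> x y; rewrite mule_ge0// lee_fin exp1_pdf_ge0.
move=> x y; rewrite mule_ge0// ?lee_fin ?unif01_pdf_ge0// integral_ge0// => e _.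
by rewrite mule_ge0// lee_fin exp1_pdf_ge0.
Qed.

Lemma ge0_integralZl_real (c : R) (f : mR -> \bar R) : 0 <= c ->
  measurable_fun setT f -> (forall x, 0 <= f x)%E ->
  (\int[mu]_x (c%:E * f x) = c%:E * \int[mu]_x f x)%E.
Proof. by move=> c0 mf f0; rewrite ge0_integralZl_EFin. Qed.

Lemma ge0_integral_swap (F : mR -> mR -> \bar R) :
  measurable_fun setT (fun p : mR * mR => F p.1 p.2) ->
  (forall x y, 0 <= F x y)%E ->
  (\int[mu]_x \int[mu]_y F x y = \int[mu]_y \int[mu]_x F x y)%E.
Proof.
move=> mF F0.
exact: (fubini_tonelli (m1 := mu) (m2 := mu) (fun p : mR * mR => F p.1 p.2)).
Qed.

Lemma weighted_ge0 (w : R) (x : \bar R) : 0 <= w -> (0 <= x -> 0 <= w%:E * x)%E.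
Proof. by move=> w0 x0; rewrite mule_ge0. Qed.

Lemma advance_ge0 phi x :
  (forall y, 0 <= phi y)%E -> (0 <= advance phi x)%E.
Proof.
move=> phi0; apply: integral_ge0 => u _; apply: weighted_ge0; first exact: unif01_pdf_ge0.
by apply: integral_ge0 => v _; apply: weighted_ge0; first exact: exp1_pdf_ge0.
Qed.

(** The density of (v, v', z') when v has density K_z, the next v is v' and the
    next s is z' / (1 - v').  The last condition says that s increases. *)
Definition joint_weight z v v' z' : R :=
  if (0 < v') && (v' < v) && (v < 1) && (z * (1 - v') < z' * (1 - v))
  then v' / (1 - v') / (1 - v) *
       expR (- (z' * (v' / (1 - v')) + z * ((v - v') / (1 - v)))) else 0.

Lemma joint_weight_ge0 z v v' z' : 0 <= joint_weight z v v' z'.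
Proof.
rewrite /joint_weight; case: ifP => // /andP[/andP[/andP[? ?] ?] _].
by rewrite mulr_ge0 ?expR_ge0// !divr_ge0 ?subr_ge0 ?ltW//; lra.
Qed.

(** Two affine substitutions: v' = v u, then z' such that
    e = v' (z' / (1 - v') - z / (1 - v)). *)
Lemma cond_mean_advance_integrand phi z v :
  measurable_fun setT phi -> (forall x, 0 <= phi x)%E ->
  ((cond_density z v)%:E * advance phi ((z / (1 - v))%R, v) =
   \int[mu]_v' \int[mu]_z' ((joint_weight z v v' z')%:E *
     phi ((z' / (1 - v'))%R, v')))%E.
Proof.
move=> mphi phi0.
have mu01 := measurable_unif01_pdf; have mexpo := measurable_exp1_pdf.
have [/andP[v0 v1]|v01] := boolP ((0 < v) && (v < 1)); last first.
  rewrite /cond_density (negbTE v01) mul0e integral0_eq// => v' _.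
  rewrite integral0_eq// => z' _; rewrite /joint_weight ifF ?mul0e//.
  apply/negP => /andP[/andP[/andP[? ?] ?] _]; move/negP: v01; apply.
  by apply/andP; split => //; lra.
have v10 : 0 < 1 - v by lra.
pose H v' : \bar R :=
  (\int[mu]_e ((exp1_pdf e)%:E * phi ((z / (1 - v) + e / v')%R, v')))%E.
have mH : measurable_fun [set: mR] H.
  apply: meas_integral; first by meas.
  by move=> x y; rewrite mule_ge0// lee_fin exp1_pdf_ge0.
have H0 v' : (0 <= H v')%E.
  by apply: integral_ge0 => e _; rewrite mule_ge0// lee_fin exp1_pdf_ge0.
rewrite [advance _ _](_ : _ = \int[mu]_u ((unif01_pdf u)%:E * H (v * u)%R))%E//.
rewrite (@ge0_integral_affine _ v^-1 0); [|
  by rewrite invr_neq0// gt_eqF|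
  by meas|
  by move=> u; apply: weighted_ge0 => //; exact: unif01_pdf_ge0].
rewrite muleA -EFinM -ge0_integralZl_real; [|
  by rewrite mulr_ge0// cond_density_ge0|
  by meas|
  by move=> u; apply: weighted_ge0 => //; exact: unif01_pdf_ge0].
apply: eq_integral => v' _.
have -> : v * (v^-1 * v' + 0) = v' by field; rewrite gt_eqF.
have -> : unif01_pdf (v^-1 * v' + 0) = if (0 < v') && (v' < v) then 1 else 0.
  rewrite /unif01_pdf addr0 [v^-1 * _]mulrC pmulr_lgt0 ?invr_gt0//.
  by rewrite ltr_pdivrMr// mul1r.
have [/andP[v'0 v'v]|v'v] := boolP ((0 < v') && (v' < v)); last first.
  rewrite mul0e mule0 integral0_eq// => z' _.
  by rewrite /joint_weight (negbTE v'v)/= mul0e.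
have v'1 : 0 < 1 - v' by lra.
rewrite mul1e.
rewrite /H (@ge0_integral_affine _ (v' / (1 - v')) (- (v' * (z / (1 - v))))); [|
  by rewrite gt_eqF// divr_gt0|
  by meas|
  by move=> u; apply: weighted_ge0 => //; exact: exp1_pdf_ge0].
rewrite muleA -EFinM -ge0_integralZl_real; [|
  by rewrite !mulr_ge0// cond_density_ge0|
  by meas|
  by move=> u; apply: weighted_ge0 => //; exact: exp1_pdf_ge0].
apply: eq_integral => z' _.
rewrite muleA -EFinM; congr (_%:E * phi (_, _))%E; last first.
  by field; rewrite !gt_eqF.
rewrite /cond_density /exp1_pdf /joint_weight v0 v1 v'0 v'v/=.
have -> : (0 < v' / (1 - v') * z' + - (v' * (z / (1 - v)))) =
   (z * (1 - v') < z' * (1 - v)).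
  rewrite -[RHS]subr_gt0.
  have -> : v' / (1 - v') * z' + - (v' * (z / (1 - v))) =
     (v' / ((1 - v') * (1 - v))) * (z' * (1 - v) - z * (1 - v')).
    by field; rewrite !gt_eqF.
  by rewrite pmulr_rgt0// divr_gt0// mulr_gt0.
case: ifPn => _; last by rewrite mulr0.
rewrite !gtr0_norm ?divr_gt0 ?invr_gt0//.
set a := expR _; set b := expR _; set c := expR _.
have -> : c = a * b.
  by rewrite /a /b /c -expRD; congr expR; field; rewrite !gt_eqF.
by field; rewrite !gt_eqF.
Qed.

(** The variable x is the ratio (1 - v) / (1 - v'). *)
Definition Zkernel_weight z z' x : R :=
  if (0 < x) && (x < 1) && (z < z' * x)
  then x^-1 * expR (- (z * ((1 - x) / x))) else 0.

Lemma Zkernel_weight_ge0 z z' x : 0 <= Zkernel_weight z z' x.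
Proof.
rewrite /Zkernel_weight; case: ifP => // /andP[/andP[x0 _] _].
by rewrite mulr_ge0 ?expR_ge0// invr_ge0 ltW.
Qed.

Definition Zkernel z z' : \bar R := (\int[mu]_x (Zkernel_weight z z' x)%:E)%E.

Lemma Zkernel_ge0 z z' : (0 <= Zkernel z z')%E.
Proof. by apply: integral_ge0 => x _; rewrite lee_fin Zkernel_weight_ge0. Qed.

Lemma Zkernel0 z z' : 0 < z -> z' <= 0 -> Zkernel z z' = 0%E.
Proof.
move=> z0 z'0; apply: integral0_eq => x _; rewrite /Zkernel_weight ifF//.
apply/negP => /andP[/andP[x0 _]]; rewrite ltNge => /negP; apply.
by rewrite (le_trans _ (ltW z0))// mulr_le0_ge0// ltW.
Qed.

Lemma measurable_Zkernel z : measurable_fun [set: mR] (Zkernel z).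
Proof.
apply: meas_integral; last by move=> x y; rewrite lee_fin Zkernel_weight_ge0.
by rewrite /Zkernel_weight; meas.
Qed.

(** With x = (1 - v) / (1 - v'), the measure dv / (1 - v) becomes dx / x and
    (v - v') / (1 - v) becomes (1 - x) / x: the integral over the old v splits
    into K_z'(v') and a factor without v'. *)
Lemma integral_joint_weight z v' z' :
  (\int[mu]_v (joint_weight z v v' z')%:E = Zkernel z z' * (cond_density z' v')%:E)%E.
Proof.
have m : measurable_fun [set: mR] (fun v : mR => (joint_weight z v v' z')%:E).
  by rewrite /joint_weight; meas.
have [/andP[v'0 v'1]|v'01] := boolP ((0 < v') && (v' < 1)); last first.
  rewrite /cond_density (negbTE v'01) mule0 integral0_eq// => v _.
  rewrite /joint_weight ifF//; apply/negP => /andP[/andP[/andP[? ?] ?] _].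
  by move/negP: v'01; apply; apply/andP; split => //; lra.
have v'10 : 0 < 1 - v' by lra.
rewrite (@ge0_integral_affine _ (- (1 - v')) 1); [|
  by rewrite oppr_eq0 gt_eqF|by []|
  by move=> v; rewrite lee_fin joint_weight_ge0].
rewrite -ge0_integralZl_real; [|by []|
  by rewrite /joint_weight; meas|by move=> v; rewrite lee_fin joint_weight_ge0].
rewrite /Zkernel -ge0_integralZr//=; [|by rewrite /Zkernel_weight; meas|
  by move=> x _; rewrite lee_fin Zkernel_weight_ge0|by rewrite lee_fin cond_density_ge0].
apply: eq_integral => x _; rewrite -!EFinM; congr EFin.
rewrite /joint_weight /Zkernel_weight /cond_density v'0 v'1/= normrN gtr0_norm//.
have -> : (v' < - (1 - v') * x + 1) = (x < 1).
  rewrite -[LHS]subr_gt0 -[RHS]subr_gt0.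
  have -> : - (1 - v') * x + 1 - v' = (1 - v') * (1 - x) by ring.
  by rewrite pmulr_rgt0.
have -> : (- (1 - v') * x + 1 < 1) = (0 < x).
  by rewrite -[LHS]subr_gt0 opprD addrCA subrr addr0 mulNr opprK pmulr_rgt0.
have -> : 1 - (- (1 - v') * x + 1) = (1 - v') * x by ring.
have -> : (z * (1 - v') < z' * ((1 - v') * x)) = (z < z' * x).
  by rewrite [(1 - v') * x]mulrC mulrA ltr_pM2r.
rewrite [(x < 1) && _]andbC; 
case: ifPn => [/andP[/andP[x0 x1] _]|_]; last by rewrite mulr0 mul0r.
set a := expR _; set b := expR _; set c := expR _.
have -> : a = b * c.
  by rewrite /a /b /c -expRD; congr expR; field; rewrite !gt_eqF.
by field; rewrite !gt_eqF.
Qed.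

Lemma cond_mean_advance phi z : measurable_fun setT phi -> (forall x, 0 <= phi x)%E ->
  (cond_mean (advance phi) z = \int[mu]_z' (Zkernel z z' * cond_mean phi z'))%E.
Proof.
move=> mphi phi0.
have sw0 := joint_weight_ge0.
transitivity (\int[mu]_v \int[mu]_v' \int[mu]_z'
    ((joint_weight z v v' z')%:E * phi ((z' / (1 - v'))%R, v')))%E.
  by apply: eq_integral => v _; rewrite cond_mean_advance_integrand.
rewrite ge0_integral_swap; [| |
  by move=> x y; rewrite integral_ge0// => w _; rewrite weighted_ge0]; last first.
  apply: meas_integral; last by move=> x y; rewrite weighted_ge0.
  by rewrite /joint_weight; meas.
transitivity (\int[mu]_v' \int[mu]_z'
    (Zkernel z z' * ((cond_density z' v')%:E * phi ((z' / (1 - v'))%R, v'))))%E.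
  apply: eq_integral => v' _; rewrite ge0_integral_swap; first last.
  - by move=> x y; rewrite weighted_ge0.
  - by rewrite /joint_weight; meas.
  apply: eq_integral => z' _; rewrite ge0_integralZr//; last first.
  - by move=> v _; rewrite lee_fin joint_weight_ge0.
  - by rewrite /joint_weight; meas.
  by rewrite integral_joint_weight muleA.
have ml := measurable_Zkernel z.
rewrite ge0_integral_swap; first last.
- by move=> x y; rewrite mule_ge0 ?Zkernel_ge0 ?weighted_ge0 ?cond_density_ge0.
- by rewrite /cond_density; meas.
apply: eq_integral => z' _; rewrite ge0_integralZl ?Zkernel_ge0//.
- by rewrite /cond_density; meas.
- by move=> x _; rewrite weighted_ge0 ?cond_density_ge0.
Qed.

(** The kernel of Z charges only (0, +oo), which is where the hypothesis
    is available. *)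
Lemma eq_cond_mean_advance phi psi z :
  measurable_fun setT phi -> (forall x, 0 <= phi x)%E ->
  measurable_fun setT psi -> (forall x, 0 <= psi x)%E ->
  (forall z', 0 < z' -> cond_mean phi z' = cond_mean psi z') ->
  0 < z -> cond_mean (advance phi) z = cond_mean (advance psi) z.
Proof.
move=> mphi phi0 mpsi psi0 h z0.
rewrite (cond_mean_advance z mphi phi0) (cond_mean_advance z mpsi psi0).
apply: eq_integral => z' _; have [z'0|z'0] := ltP 0 z'; first by rewrite h.
by rewrite (Zkernel0 z0 z'0) !mul0e.
Qed.

End kernels.

(** * An integration by parts *)

Section invexp.
Context {R : realType}.
Local Notation mu := (@lebesgue_measure R).
Local Notation mR := (measurableTypeR R).
Variable z : R.
Hypothesis z0 : 0 < z.

Let F (w : R) := if 0 < w then expR (- (z / w)) else 0.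
Let f (w : R) := if 0 < w then z / w ^+ 2 * expR (- (z / w)) else 0.

Lemma is_derive_exp_inv (w : R) : 0 < w -> is_derive w 1 F (f w).
Proof.
move=> w0.
have wn0 : w != 0 by rewrite gt_eqF.
have d : is_derive w 1 (fun w => expR (- (z / w))) (f w).
  have -> : (fun w => expR (- (z / w))) = expR \o (fun w => - z *: w^-1).
    by apply/funext => x /=; rewrite scaleNr.
  have dV : is_derive w 1 (fun x : R => x^-1) (- w ^- 2 *: 1).
    exact: is_deriveV.
  apply: is_derive_eq; rewrite /f w0.
  by rewrite /GRing.scale/= mulNr mulr1 mulrNN mulrC.
apply: near_eq_is_derive d.
by near=> y; rewrite /F ifT//; near: y; exact: lt_nbhsr.
Unshelve. all: by end_near. Qed.

(** exp (- t) <= 1 / t for t = z / w. *)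
Lemma exp_inv_cvg_right0 : F x @[x --> 0^'+] --> F 0.
Proof.
rewrite {2}/F ltxx; apply: (@squeeze_cvgr _ _ _ _ (cst 0) (fun w => w / z)).
- near=> w; rewrite /F.
  have w0 : 0 < w by [].
  rewrite w0 expR_ge0/= expRN -[leRHS]invf_div lef_pV2 ?posrE ?expR_gt0 ?divr_gt0//.
  by rewrite (le_trans _ (expR_ge1Dx _))// lerDr.
- exact: cvg_cst.
- rewrite -[X in _ --> X](mul0r z^-1); apply: cvg_at_right_filter.
  by apply: cvgMr_tmp; exact: cvg_id.
Unshelve. all: by end_near. Qed.

(** exp (- t) <= 6 / t^3 for t = z / w absorbs the factor w^-2. *)
Lemma deriv_exp_inv_cvg_right0 : f x @[x --> 0^'+] --> f 0.
Proof.
rewrite {2}/f ltxx; apply: (@squeeze_cvgr _ _ _ _ (cst 0) (fun w => w * (6 / z ^+ 2))).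
- near=> w; rewrite /f.
  have w0 : 0 < w by [].
  rewrite w0 mulr_ge0 ?expR_ge0 ?divr_ge0 ?sqr_ge0 ?(ltW z0)//=.
  have h : (z / w) ^+ 3 / 6 <= expR (z / w).
    apply: le_trans (expR_ge1Dxn 2 _); last by rewrite divr_ge0// ltW.
    by rewrite ler_wpDl.
  have -> : w * (6 / z ^+ 2) = z / w ^+ 2 * ((z / w) ^+ 3 / 6)^-1.
    by field; rewrite !gt_eqF.
  rewrite ler_pM2l ?divr_gt0 ?exprn_gt0// expRN lef_pV2 ?posrE ?expR_gt0//.
  by rewrite divr_gt0// exprn_gt0// divr_gt0.
- exact: cvg_cst.
- rewrite -[X in _ --> X](mul0r (6 / z ^+ 2)); apply: cvg_at_right_filter.
  by apply: cvgMr_tmp; exact: cvg_id.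
Unshelve. all: by end_near. Qed.

Lemma deriv_exp_inv_continuous (w : R) : 0 < w -> {for w, continuous f}.
Proof.
move=> w0.
have wn0 : w != 0 by rewrite gt_eqF.
have cV : {for w, continuous (fun x : R => x^-1)} by exact: inv_continuous.
have c : {for w, continuous (fun w : R => z * (w^-1 * w^-1) * expR (- (z * w^-1)))}.
  apply: cvgM.
    by apply: cvgM; [exact: cvg_cst|apply: cvgM].
  apply: (@cvg_comp _ _ _ (fun w : R => - (z * w^-1)) expR); last exact: continuous_expR.
  by apply: cvgN; apply: cvgM => //; exact: cvg_cst.
rewrite /prop_for /continuous_at.
have -> : f w = z * (w^-1 * w^-1) * expR (- (z * w^-1)).
  by rewrite /f w0 expr2 invfM.
apply: cvg_trans c; apply: near_eq_cvg; near=> y.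
rewrite /f ifT ?expr2 ?invfM//; near: y; exact: lt_nbhsr.
Unshelve. all: by end_near. Qed.

Lemma integral_deriv_exp_inv (c : R) : 0 < c ->
  (\int[mu]_w (if (0 < w) && (w < c) then z / w ^+ 2 * expR (- (z / w)) else 0)%:E
   = (expR (- (z / c)))%:E)%E.
Proof.
move=> c0.
transitivity (\int[mu]_(w in `[0%R, c]) (f w)%:E)%E; last first.
  rewrite (@continuous_FTC2 _ f F)//.
  - by rewrite /F c0 ltxx sube0.
  - apply/continuous_within_itvP => //; split.
    + by move=> w; rewrite in_itv/= => /andP[w0 _]; exact: deriv_exp_inv_continuous.
    + exact: deriv_exp_inv_cvg_right0.
    + by apply: cvg_at_left_filter; exact: deriv_exp_inv_continuous.
  - split.
    + by move=> w; rewrite in_itv/= => /andP[/is_derive_exp_inv[]].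
    + exact: exp_inv_cvg_right0.
    + apply: cvg_at_left_filter.
      apply: differentiable_continuous; apply/derivable1_diffP.
      by case: (is_derive_exp_inv c0).
  - move=> w; rewrite in_itv/= => /andP[/is_derive_exp_inv dF _].
    by rewrite derive1E; exact: derive_val.
rewrite integral_itv_bndoo; last first.
  by apply: measurable_funTS; rewrite /f; meas.
rewrite [RHS]integral_mkcond; apply: eq_integral => w _; rewrite patchE.
have -> : (w \in `]0, c[%classic) = (0 < w) && (w < c).
  by apply/idP/idP; rewrite inE/= in_itv.
by rewrite /f; case: ifPn => // /andP[-> _].
Qed.

End invexp.

Section odds_exponential_balance.
Context {R : realType}.
Local Notation mu := (@lebesgue_measure R).
Local Notation mR := (measurableTypeR R).

Lemma integral_itv01 (a b : R) : a <= b ->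
  (\int[mu]_w (if (a < w) && (w < b) then 1 else 0 : R)%:E = (b - a)%:E)%E.
Proof.
move=> ab; transitivity (\int[mu]_(x in `]a, b[) 1)%E.
  rewrite [RHS]integral_mkcond; apply: eq_integral => w _; rewrite patchE.
  have -> : (w \in `]a, b[%classic) = (a < w) && (w < b).
    by apply/idP/idP; rewrite inE/= in_itv.
  by case: ifP.
rewrite integral_cst// mul1e /= lebesgue_measure_itv/= lte_fin.
by case: ltgtP ab => // -> _; rewrite subrr.
Qed.

(** Substituting w = 1 - v, the exponential becomes
    exp (z - z / w), which is the integral over (0, w) of its derivative; the
    exchange of the integrals over y < w leaves the length 1 - y, that is, the
    new factor v. *)
Lemma odds_exponential_balance (z : R) : 0 < z ->
  (\int[mu]_v (if (0 < v) && (v < 1) then expR (- (z * (v / (1 - v)))) else 0)%:E =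
   \int[mu]_v (if (0 < v) && (v < 1) then
      z * v / (1 - v) ^+ 2 * expR (- (z * (v / (1 - v)))) else 0)%:E)%E.
Proof.
move=> z0.
pose h w y : R := if (0 < y) && (y < w) && (w < 1) then
  z / y ^+ 2 * expR (z - z / y) else 0.
have h0 w y : 0 <= h w y.
  rewrite /h; case: ifP => // /andP[/andP[y0 _] _].
  by rewrite mulr_ge0 ?expR_ge0 ?divr_ge0 ?exprn_ge0 ?ltW.
have mh : measurable_fun setT (fun p : mR * mR => (h p.1 p.2)%:E).
  by rewrite /h; meas.
transitivity (\int[mu]_w \int[mu]_y (h w y)%:E)%E.
  rewrite (@ge0_integral_affine _ (-1) 1); [| | by meas |]; last 2 first.
  - by rewrite oppr_eq0 oner_eq0.
  - by move=> v; case: ifP; rewrite lee_fin// expR_ge0.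
  rewrite normrN1 mul1e; apply: eq_integral => w _.
  have -> : (0 < -1 * w + 1) = (w < 1) by rewrite mulN1r addrC subr_gt0.
  have -> : (-1 * w + 1 < 1) = (0 < w) by rewrite mulN1r gtrDr oppr_lt0.
  have [/andP[w1 w0]|w01] := boolP ((w < 1) && (0 < w)); last first.
    rewrite integral0_eq// => y _; rewrite /h ifF//.
    apply/negP => /andP[/andP[y0 yw] w1]; move/negP: w01; apply.
    by rewrite w1 (lt_trans y0).
  transitivity ((expR z)%:E * (expR (- (z / w)))%:E)%E.
    rewrite -EFinM -expRD; congr (expR _)%:E.
    by field; rewrite gt_eqF.
  rewrite -integral_deriv_exp_inv// -ge0_integralZl_real ?expR_ge0//; last 2 first.
  - by meas.
  - move=> y; rewrite lee_fin; case: ifP => // /andP[y0 _].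
    by rewrite mulr_ge0 ?expR_ge0 ?divr_ge0 ?exprn_ge0 ?ltW.
  apply: eq_integral => y _; rewrite -EFinM; congr EFin; rewrite /h w1 andbT.
  by case: ifP => _; rewrite ?mulr0// expRD mulrCA.
rewrite ge0_integral_swap; [|exact: mh|by move=> x y; rewrite lee_fin].
rewrite [RHS](@ge0_integral_affine _ (-1) 1); last 3 first.
- by rewrite oppr_eq0 oner_eq0.
- by meas.
- move=> v; case: ifP; rewrite lee_fin// => /andP[v0 v1].
  by rewrite mulr_ge0 ?expR_ge0 ?divr_ge0 ?exprn_ge0 ?mulr_ge0 ?subr_ge0 ?ltW.
rewrite normrN1 mul1e; apply: eq_integral => y _.
have -> : (0 < -1 * y + 1) = (y < 1) by rewrite mulN1r addrC subr_gt0.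
have -> : (-1 * y + 1 < 1) = (0 < y) by rewrite mulN1r gtrDr oppr_lt0.
have [/andP[y1 y0]|y01] := boolP ((y < 1) && (0 < y)); last first.
  rewrite integral0_eq// => w _; rewrite /h ifF//.
  apply/negP => /andP[/andP[y0 yw] w1]; move/negP: y01; apply.
  by rewrite y0 (lt_trans yw).
transitivity ((z / y ^+ 2 * expR (z - z / y))%:E * (1 - y)%:E)%E; last first.
  rewrite -EFinM; congr EFin.
  have -> : 1 - (-1 * y + 1) = y by ring.
  have -> : - (z * ((-1 * y + 1) / y)) = z - z / y.
    by field; rewrite gt_eqF.
  by field; rewrite gt_eqF.
rewrite -integral_itv01 ?ltW// -ge0_integralZl_real; last 3 first.
- by rewrite mulr_ge0 ?expR_ge0 ?divr_ge0 ?exprn_ge0 ?ltW.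
- by meas.
- by move=> w; case: ifP.
apply: eq_integral => w _; rewrite /h y0/= -EFinM.
by case: ifP => _; rewrite ?mulr1 ?mulr0.
Qed.

End odds_exponential_balance.

(** * The initial step and the two final averages *)

Section final.
Context {R : realType}.
Local Notation mu := (@lebesgue_measure R).
Local Notation mR := (measurableTypeR R).
Implicit Types (phi psi : mR * mR -> \bar R) (f : mR -> \bar R) (z v u e s : R).

(** The chain starts at (0, 1); from there S_1 = E / U and the substitution
    e = u z / (1 - u) produces K_z(u) at once. *)
Lemma advance_start phi : measurable_fun setT phi -> (forall x, 0 <= phi x)%E ->
  (advance phi (0%R, 1%R) =
   \int[mu]_z ((if (0 < z)%R then 1 else 0 : R)%:E * cond_mean phi z))%E.
Proof.
move=> mphi phi0; have mexpo := @measurable_exp1_pdf R.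
have cond_density0 := @cond_density_ge0 R.
transitivity (\int[mu]_u \int[mu]_z ((if 0 < z then cond_density z u else 0)%R%:E *
    phi ((z / (1 - u))%R, u)))%E.
  apply: eq_integral => u _ /=; rewrite mul1r.
  rewrite /unif01_pdf; have [/andP[u0 u1]|u01] := boolP ((0 < u) && (u < 1)); last first.
    rewrite mul0e integral0_eq// => z _.
    by rewrite /cond_density (negbTE u01); case: ifP; rewrite mul0e.
  have v10 : 0 < 1 - u by lra.
  rewrite mul1e (@ge0_integral_affine _ (u / (1 - u)) 0); [|
    by rewrite gt_eqF// divr_gt0|by meas|
    by move=> e; apply: weighted_ge0 => //; exact: exp1_pdf_ge0].
  rewrite -ge0_integralZl_real; [|by []|by meas|
    by move=> e; apply: weighted_ge0 => //; exact: exp1_pdf_ge0].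
  apply: eq_integral => z _; rewrite muleA -EFinM.
  congr (_%:E * phi (_, _))%E; last by field; rewrite !gt_eqF.
  rewrite addr0 /exp1_pdf /cond_density u0 u1 pmulr_rgt0 ?divr_gt0//.
  case: ifP => _; last by rewrite mulr0.
  by rewrite gtr0_norm ?divr_gt0// [z * _]mulrC.
rewrite ge0_integral_swap; first last.
- by move=> u z; apply: weighted_ge0 => //; case: ifP.
- by rewrite /cond_density; meas.
apply: eq_integral => z _; case: ifP => z0.
  by rewrite mul1e.
by rewrite mul0e integral0_eq// => u _; rewrite mul0e.
Qed.

(** The averages of f (s (1 - v U)) over U and of f ((s + E) (1 - v)) over E. *)
Definition lhs_mean f (x : mR * mR) : \bar R :=
  (\int[mu]_u ((unif01_pdf u)%:E * f (x.1 * (1 - x.2 * u))%R))%E.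

Definition rhs_mean f (x : mR * mR) : \bar R :=
  (\int[mu]_e ((exp1_pdf e)%:E * f ((x.1 + e) * (1 - x.2))%R))%E.

Lemma lhs_mean_ge0 f x : (forall y, 0 <= f y)%E -> (0 <= lhs_mean f x)%E.
Proof.
by move=> f0; apply: integral_ge0 => u _; rewrite weighted_ge0 ?unif01_pdf_ge0. Qed.

Lemma rhs_mean_ge0 f x : (forall y, 0 <= f y)%E -> (0 <= rhs_mean f x)%E.
Proof.
by move=> f0; apply: integral_ge0 => u _; rewrite weighted_ge0 ?exp1_pdf_ge0. Qed.

Lemma measurable_lhs_mean f : measurable_fun setT f -> (forall y, 0 <= f y)%E ->
  measurable_fun setT (lhs_mean f).
Proof.
move=> mf f0; have mu01 := @measurable_unif01_pdf R.
apply: meas_integral; last by move=> x y; rewrite weighted_ge0 ?unif01_pdf_ge0.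
by meas.
Qed.

Lemma measurable_rhs_mean f : measurable_fun setT f -> (forall y, 0 <= f y)%E ->
  measurable_fun setT (rhs_mean f).
Proof.
move=> mf f0; have mexpo := @measurable_exp1_pdf R.
apply: meas_integral; last by move=> x y; rewrite weighted_ge0 ?exp1_pdf_ge0.
by meas.
Qed.

Let tail z z' : R := if z < z' then expR (z - z') else 0.
Let tail_ge0 z z' : 0 <= tail z z'.
Proof. by rewrite /tail; case: ifP => // _; exact: expR_ge0. Qed.

(** First z' = z (1 - v u) / (1 - v) replaces u; for fixed z' the substitution
    of (z / z') (1 - v) for 1 - v then removes z from the remaining integral
    over v. *)
Lemma cond_mean_lhs f z :
  measurable_fun setT f -> (forall y, 0 <= f y)%E -> 0 < z ->
  (cond_mean (lhs_mean f) z = \int[mu]_z' ((tail z z' / z')%:E *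
     (\int[mu]_v (if (0 < v)%R && (v < 1)%R then
       expR (- (z' * (v / (1 - v)))) else 0)%R%:E)
     * f z'))%E.
Proof.
move=> mf f0 z0; have mu01 := @measurable_unif01_pdf R.
pose w v z' : R := if (0 < v) && (v < 1) && (z < z') && (z' * (1 - v) < z) then
  expR (- (z * (v / (1 - v)))) / z else 0.
have w0 v z' : 0 <= w v z'.
  by rewrite /w; case: ifP => // _; rewrite divr_ge0 ?expR_ge0// ltW.
transitivity (\int[mu]_v \int[mu]_z' ((w v z')%:E * f z'))%E.
  apply: eq_integral => v _.
  have [/andP[v0 v1]|v01] := boolP ((0 < v) && (v < 1)); last first.
    rewrite /cond_density (negbTE v01) mul0e integral0_eq// => z' _.
    by rewrite /w (negbTE v01) mul0e.
  have v10 : 0 < 1 - v by lra.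
  have c0 : 0 < (1 - v) / (z * v) by rewrite divr_gt0// mulr_gt0.
  rewrite /lhs_mean/= (@ge0_integral_affine _ (- ((1 - v) / (z * v))) v^-1); [|
    by rewrite oppr_eq0 gt_eqF|by meas|by move=> u; rewrite weighted_ge0 ?unif01_pdf_ge0].
  rewrite muleA -EFinM -ge0_integralZl_real; [| | by meas|
    by move=> u; rewrite weighted_ge0 ?unif01_pdf_ge0]; last first.
    by rewrite mulr_ge0 ?cond_density_ge0.
  apply: eq_integral => z' _; rewrite muleA -EFinM.
  congr (_%:E * f _)%E; last by field; rewrite !gt_eqF.
  rewrite /w /cond_density /unif01_pdf v0 v1/= normrN gtr0_norm//.
  have -> : (0 < - ((1 - v) / (z * v)) * z' + v^-1) = (z' * (1 - v) < z).
    have -> : - ((1 - v) / (z * v)) * z' + v^-1 = (z * v)^-1 * (z - z' * (1 - v)).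
      by field; rewrite !gt_eqF.
    by rewrite pmulr_rgt0 ?invr_gt0 ?mulr_gt0// subr_gt0.
  have -> : (- ((1 - v) / (z * v)) * z' + v^-1 < 1) = (z < z').
    rewrite -[LHS]subr_gt0.
    have -> : 1 - (- ((1 - v) / (z * v)) * z' + v^-1) =
      (1 - v) / (z * v) * (z' - z) by field; rewrite !gt_eqF.
    by rewrite pmulr_rgt0// subr_gt0.
  rewrite [(z < z') && _]andbC; case: ifPn => _; last by rewrite mulr0.
  by field; rewrite !gt_eqF.
rewrite ge0_integral_swap; first last.
- by move=> v z'; apply: weighted_ge0.
- by rewrite /w; meas.
apply: eq_integral => z' _; rewrite ge0_integralZr//; last first.
- by move=> v _; rewrite lee_fin w0.
- by rewrite /w; meas.
congr (_ * _)%E.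
have [zz'|zz'] := ltP z z'; last first.
  rewrite /tail (le_gtF zz') mul0r mul0e integral0_eq// => v _.
  by rewrite /w (le_gtF zz') andbF.
have z'0 : 0 < z' by exact: lt_trans zz'.
have z'z0 : 0 < z / z' by rewrite divr_gt0.
rewrite [LHS](@ge0_integral_affine _ (z / z') (1 - z / z')); [|
  by rewrite gt_eqF|by rewrite /w; meas|by move=> v; rewrite lee_fin w0].
rewrite -[LHS]ge0_integralZl_real; [|by []|by rewrite /w; meas|
  by move=> v; rewrite lee_fin w0].
rewrite -[RHS]ge0_integralZl_real; [| |by meas|
  by move=> v; rewrite lee_fin; case: ifP => // _; exact: expR_ge0]; last first.
  by rewrite divr_ge0 ?tail_ge0// ltW.
apply: eq_integral => v _; rewrite -!EFinM; congr EFin.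
rewrite /tail zz' gtr0_norm// /w zz' andbT.
have -> : 1 - (z / z' * v + (1 - z / z')) = z / z' * (1 - v) by ring.
have -> : (z' * (z / z' * (1 - v)) < z) = (0 < v).
  rewrite mulrA (_ : z' * (z / z') = z); last by field; rewrite gt_eqF.
  by rewrite gtr_pMr// gtrBl.
have -> : (z / z' * v + (1 - z / z') < 1) = (v < 1).
  rewrite -[LHS]subr_gt0.
  have -> : 1 - (z / z' * v + (1 - z / z')) = z / z' * (1 - v) by ring.
  by rewrite pmulr_rgt0// subr_gt0.
rewrite [in RHS]andbC -andbA andbC.
have [/andP[v1 v0]|_] := boolP ((v < 1) && (0 < v)); last by rewrite !mulr0.
rewrite ifT; last first.
  rewrite /=; apply: addr_gt0; first exact: mulr_gt0.
  by rewrite subr_gt0 ltr_pdivrMr// mul1r.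
set a := expR _; set b := expR _; set c := expR _.
have -> : a = b * c.
  rewrite /a /b /c -expRD; congr expR; field; rewrite !gt_eqF//; lra.
by field; rewrite !gt_eqF.
Qed.

(** Here z' = z + e (1 - v) replaces e, and z already separates from v. *)
Lemma cond_mean_rhs f z :
  measurable_fun setT f -> (forall y, 0 <= f y)%E -> 0 < z ->
  (cond_mean (rhs_mean f) z = \int[mu]_z' ((tail z z' / z')%:E *
     (\int[mu]_v (if (0 < v)%R && (v < 1)%R then
       z' * v / (1 - v) ^+ 2 * expR (- (z' * (v / (1 - v)))) else 0)%R%:E)
     * f z'))%E.
Proof.
move=> mf f0 z0; have mexpo := @measurable_exp1_pdf R.
pose w v z' : R := if (0 < v) && (v < 1) && (z < z') then
  tail z z' * (v / (1 - v) ^+ 2 * expR (- (z' * (v / (1 - v))))) else 0.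
have w0 v z' : 0 <= w v z'.
  rewrite /w; case: ifP => // /andP[/andP[v0 v1] _].
  by rewrite !mulr_ge0 ?expR_ge0 ?tail_ge0 ?invr_ge0 ?exprn_ge0 ?subr_ge0 ?ltW.
transitivity (\int[mu]_v \int[mu]_z' ((w v z')%:E * f z'))%E.
  apply: eq_integral => v _.
  have [/andP[v0 v1]|v01] := boolP ((0 < v) && (v < 1)); last first.
    rewrite /cond_density (negbTE v01) mul0e integral0_eq// => z' _.
    by rewrite /w (negbTE v01) mul0e.
  have v10 : 0 < 1 - v by lra.
  rewrite /rhs_mean/= (@ge0_integral_affine _ (1 - v)^-1 (- (z / (1 - v)))); [|
    by rewrite invr_neq0// gt_eqF|by meas|by move=> u; rewrite weighted_ge0 ?exp1_pdf_ge0].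
  rewrite muleA -EFinM -ge0_integralZl_real; [| | by meas|
    by move=> u; rewrite weighted_ge0 ?exp1_pdf_ge0]; last first.
    by rewrite mulr_ge0 ?cond_density_ge0.
  apply: eq_integral => z' _; rewrite muleA -EFinM.
  congr (_%:E * f _)%E; last by field; rewrite !gt_eqF.
  rewrite /w /cond_density /exp1_pdf /tail v0 v1/= gtr0_norm ?invr_gt0//.
  have -> : (0 < (1 - v)^-1 * z' + - (z / (1 - v))) = (z < z').
    have -> : (1 - v)^-1 * z' + - (z / (1 - v)) = (1 - v)^-1 * (z' - z).
      by field; rewrite gt_eqF.
    by rewrite pmulr_rgt0 ?invr_gt0// subr_gt0.
  case: ifPn => _; last by rewrite mulr0.
  set a := expR _; set b := expR _; set c := expR _; set e := expR _.
  have -> : b = c * e / a.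
    rewrite /a /b /c /e -expRN -!expRD; congr expR; field; rewrite !gt_eqF//.
  by field; rewrite !gt_eqF ?expR_gt0.
rewrite ge0_integral_swap; first last.
- by move=> v z'; apply: weighted_ge0.
- by rewrite /w /tail; meas.
apply: eq_integral => z' _; rewrite ge0_integralZr//; last first.
- by move=> v _; rewrite lee_fin w0.
- by rewrite /w /tail; meas.
congr (_ * _)%E.
have [zz'|zz'] := ltP z z'; last first.
  rewrite /tail (le_gtF zz') mul0r mul0e integral0_eq// => v _.
  by rewrite /w (le_gtF zz') andbF.
have z'0 : 0 < z' by exact: lt_trans zz'.
rewrite -[RHS]ge0_integralZl_real; [| |by meas|]; last 2 first.
- by rewrite divr_ge0 ?tail_ge0// ltW.
- move=> v; rewrite lee_fin; case: ifP => // /andP[v0 v1].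
  by rewrite !mulr_ge0 ?expR_ge0 ?invr_ge0 ?exprn_ge0 ?subr_ge0 ?ltW.
apply: eq_integral => v _; rewrite -!EFinM; congr EFin.
rewrite /w zz' andbT; case: ifP => [/andP[v0 v1]|_]; last by rewrite mulr0.
by field; rewrite !gt_eqF ?subr_gt0.
Qed.

Lemma eq_cond_mean_lhs_rhs f z :
  measurable_fun setT f -> (forall y, 0 <= f y)%E -> 0 < z ->
  cond_mean (lhs_mean f) z = cond_mean (rhs_mean f) z.
Proof.
move=> mf f0 z0; rewrite (cond_mean_lhs mf f0 z0) (cond_mean_rhs mf f0 z0).
apply: eq_integral => z' _.
have [zz'|zz'] := ltP z z'; last first.
  by rewrite /tail (le_gtF zz') mul0r !mul0e.
by rewrite (odds_exponential_balance (lt_trans z0 zz')).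
Qed.

End final.

(** * Feeding independent inputs one at a time *)

Section law_on.
Context d d' (T : measurableType d) (S : measurableType d') (R : realType).
Variables (P : probability T R) (F : set T) (mF : measurable F)
  (X : T -> S) (mX : measurable_fun setT X).
Local Open Scope ereal_scope.

(** The law of X on the event F, without normalisation.  The two measurability
    proofs are arguments so that the measure structure can be attached to it. *)
Definition law_on of measurable F & measurable_fun setT X :=
  fun A => P (X @^-1` A `&` F).
Local Notation m := (law_on mF mX).

Let m0 : m set0 = 0. Proof. by rewrite /law_on preimage_set0 set0I. Qed.
Let m_ge0 A : 0 <= m A. Proof. exact: measure_ge0. Qed.
Let m_sigma_additive : semi_sigma_additive m.
Proof. exact: (@measure_semi_sigma_additive _ _ _ (pushforward (mrestr P mF) X)). Qed.

HB.instance Definition _ := isMeasure.Build _ _ _ m m0 m_ge0 m_sigma_additive.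

Let m_fin : fin_num_fun m.
Proof.
move=> A mA; apply: fin_num_measure; apply: measurableI => //.
by rewrite -[X @^-1` A]setTI; exact: mX.
Qed.

HB.instance Definition _ := Measure_isFinite.Build _ _ _ m m_fin.
End law_on.

Section independence_step.
Context d (T : measurableType d) (R : realType) (P : probability T R).
Context (I : choiceType) (Y : I -> {RV P >-> R}).
Hypothesis indepY : mutually_independent_RVs Y.
Local Open Scope ereal_scope.

Definition cylinder (J : {fset I}) (B : I -> set R) : set T :=
  \bigcap_(i in [set` J]) Y i @^-1` B i.

Lemma measurable_preim i B : measurable B -> measurable (Y i @^-1` B).
Proof. by move=> mB; rewrite -[_ @^-1` _]setTI; exact: measurable_funP. Qed.

Lemma measurable_cylinder J B : (forall i, measurable (B i)) ->
  measurable (cylinder J B).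
Proof.
move=> mB; apply: fin_bigcap_measurable; first exact: finite_fset.
by move=> i _; exact: measurable_preim.
Qed.

Lemma cylinder_cons i J B C : i \notin J ->
  Y i @^-1` C `&` cylinder J B =
  cylinder (i |` J)%fset (fun j => if j == i then C else B j).
Proof.
move=> iJ; apply/seteqP; split => [w [Cw Bw] j /=|w Bw].
  rewrite !inE; case: eqP => [-> //|ji /= jJ]; exact: Bw.
split; first by have := Bw i; rewrite /= fset1U1 eqxx; exact.
move=> j /= jJ; have := Bw j; rewrite /= fset1Ur// => /(_ isT).
by case: eqP => // ji; rewrite -ji jJ in iJ.
Qed.

Lemma independent_cylinder i J B C : i \notin J -> measurable C ->
  (forall i, measurable (B i)) ->
  P (Y i @^-1` C `&` cylinder J B) = P (Y i @^-1` C) * P (cylinder J B).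
Proof.
move=> iJ mC mB; rewrite cylinder_cons// /cylinder indepY; last first.
  by move=> j; case: ifP.
rewrite indepY// big_fsetU1//= eqxx; congr (_ * _).
apply: eq_big_seq => j jJ; case: eqP => // ji.
by rewrite -ji jJ in iJ.
Qed.

(** X has been computed from the inputs with index in D: it is independent of
    every finite block of the other inputs. *)
Definition independent_outside d' (S : measurableType d') (D : set I)
    (X : T -> S) :=
  measurable_fun setT X /\
  forall A J B, measurable A -> (forall i, measurable (B i)) ->
    (forall i, i \in J -> ~ D i) ->
    P (X @^-1` A `&` cylinder J B) = P (X @^-1` A) * P (cylinder J B).

Lemma independent_outside_comp d1 d2 (S1 : measurableType d1)
    (S2 : measurableType d2) (g : S1 -> S2) D (X : T -> S1) :
  measurable_fun setT g -> independent_outside D X ->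
  independent_outside D (g \o X).
Proof.
move=> mg [mX iX]; split; first exact: measurableT_comp.
move=> A J B mA mB JD; rewrite comp_preimage iX//.
by rewrite -[_ @^-1` _]setTI; exact: mg.
Qed.

Lemma independent_outside_cst d' (S : measurableType d') (x : S) D :
  independent_outside D (fun=> x).
Proof.
split=> // A J B _ _ _; rewrite preimage_cst; case: ifP => _.
  by rewrite setTI probability_setT mul1e.
by rewrite set0I measure0 mul0e.
Qed.

Lemma independent_outside_sub d' (S : measurableType d') (D D' : set I)
    (X : T -> S) :
  D `<=` D' -> independent_outside D X -> independent_outside D' X.
Proof.
move=> DD' [mX iX]; split => // A J B mA mB JD; apply: iX => // i /JD D'i.
by move/DD'.
Qed.

Section one_more.
Context d' (S : measurableType d') (D : set I) (X : T -> S) (i : I).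
Hypotheses (iX : independent_outside D X) (Di : ~ D i).
Let mX : measurable_fun setT X. Proof. by case: iX. Qed.
Let mY : measurable_fun setT (Y i : T -> measurableTypeR R).
Proof. exact: (@measurable_funPT _ _ _ _ (Y i)). Qed.
Let XY w : S * measurableTypeR R := (X w, Y i w).
Let mXY : measurable_fun setT XY.
Proof. exact: measurable_fun_pair. Qed.

(** A measure that is a product on rectangles is a product measure. *)
Let joint_law F (mF : measurable F) A : measurable A ->
  (forall B C, measurable B -> measurable C ->
    P (X @^-1` B `&` (Y i @^-1` C `&` F)) =
    P (X @^-1` B) * P (Y i @^-1` C `&` F)) ->
  law_on P mF mXY A = (law_on P measurableT mX \x law_on P mF mY) A.
Proof.
move=> mA XYF; apply/esym/product_measure_unique => // B C mB mC.
by rewrite /= /law_on setIT -XYF// setIA.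
Qed.

Let indepXY B C : measurable B -> measurable C ->
  P (X @^-1` B `&` (Y i @^-1` C `&` setT)) =
  P (X @^-1` B) * P (Y i @^-1` C `&` setT).
Proof.
move=> mB mC; have c0 : setT = cylinder fset0 (fun=> setT).
  by apply/seteqP; split.
rewrite c0 cylinder_cons//; apply: iX.2 => //; first by move=> j; case: ifP.
by move=> j; rewrite !inE => /predU1P[->|].
Qed.

(** On an event F of later inputs, the joint law of X and Y_i is a product
    whose second factor is P(F) times the law of Y_i, because Y_i and F are
    independent.  So the joint law of X and Y_i is itself scaled by P(F). *)
Lemma independent_outside_pair : independent_outside [set j | D j \/ j = i] XY.
Proof.
split=> // A J B mA mB JD.
have mF := measurable_cylinder J mB.
have iJ : i \notin J by apply/negP => /JD; apply; right.
rewrite -[LHS]/(law_on P mF mXY A) joint_law//; last first.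
  move=> B' C mB' mC; rewrite cylinder_cons//; apply: iX.2 => //.
    by move=> j; case: ifP.
  move=> j; rewrite !inE => /predU1P[-> //|/JD jD Dj].
  by apply: jD; left.
have -> : P (XY @^-1` A) = law_on P measurableT mXY A by rewrite /law_on setIT.
rewrite joint_law// /product_measure1/= -ge0_integralZr//=; last first.
  exact: measurable_fun_xsection.
apply: eq_integral => x _ /=; rewrite /law_on setIT.
by apply: independent_cylinder => //; exact: measurable_xsection.
Qed.

Lemma integral_independent (h : S * measurableTypeR R -> \bar R) :
  measurable_fun setT h -> (forall x, 0 <= h x) ->
  \int[P]_w h (X w, Y i w) = \int[P]_w \int[P]_w' h (X w, Y i w').
Proof.
move=> mh h0.
have law_onT d2 (S2 : measurableType d2) (Z : T -> S2) (mZ : measurable_fun setT Z)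
    (k : S2 -> \bar R) : measurable_fun setT k -> (forall x, 0 <= k x) ->
    \int[law_on P measurableT mZ]_x k x = \int[P]_w k (Z w).
  move=> mk k0; transitivity (\int[pushforward P Z]_x k x).
    by apply: eq_measure_integral => A mA _; rewrite /= /law_on setIT.
  by rewrite ge0_integral_pushforward.
transitivity (\int[law_on P measurableT mXY]_x h x).
  by rewrite law_onT.
transitivity (\int[law_on P measurableT mX \x law_on P measurableT mY]_x h x).
  by apply: eq_measure_integral => A mA _; exact: joint_law.
rewrite fubini_tonelli1//= law_onT; last 2 first.
- exact: measurable_fun_fubini_tonelli_F.
- by move=> x; apply: integral_ge0.
by apply: eq_integral => w _; rewrite /fubini_F law_onT//; exact: measurableT_comp.
Qed.

End one_more.
End independence_step.

Section laws.
Context d (T : measurableType d) (R : realType) (P : probability T R).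
Local Notation mu := (@lebesgue_measure R).
Local Notation mR := (measurableTypeR R).
Local Open Scope ereal_scope.

Lemma integral_uniform_RV (X : {RV P >-> R}) (h : mR -> \bar R) :
  uniformly_distributed ltr01 X -> measurable_fun setT h ->
  (forall x, 0 <= h x) ->
  \int[P]_w h (X w) = \int[mu]_u ((unif01_pdf u)%:E * h u).
Proof.
move=> unifX mh h0.
have mX : measurable_fun setT (X : T -> mR)
  by exact: (@measurable_funPT _ _ _ _ X).
transitivity (\int[pushforward P (X : T -> mR)]_x h x).
  by rewrite ge0_integral_pushforward.
transitivity (\int[uniform_prob (@ltr01 R)]_x h x).
  by apply: eq_measure_integral => A mA _; exact: unifX.
rewrite integral_uniform// subr0 invr1 mul1e integral_itv_bndoo; last first.
  exact: measurable_funTS.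
rewrite integral_mkcond; apply: eq_integral => u _; rewrite patchE.
have -> : (u \in `]0%R, 1%R[%classic) = ((0 < u) && (u < 1))%R.
  by apply/idP/idP; rewrite inE/= in_itv.
by rewrite /unif01_pdf; case: ifP => _; rewrite ?mul1e ?mul0e.
Qed.

Lemma integral_exponential_RV (X : {RV P >-> R}) (h : mR -> \bar R) :
  exponentially_distributed 1 X -> measurable_fun setT h ->
  (forall x, 0 <= h x) ->
  \int[P]_w h (X w) = \int[mu]_e ((exp1_pdf e)%:E * h e).
Proof.
move=> expX mh h0.
have mX : measurable_fun setT (X : T -> mR)
  by exact: (@measurable_funPT _ _ _ _ X).
transitivity (\int[law_on P measurableT mX]_x h x).
  transitivity (\int[pushforward P (X : T -> mR)]_x h x).
    by rewrite ge0_integral_pushforward.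
  by apply: eq_measure_integral => A mA _; rewrite /= /law_on setIT.
rewrite (@ge0_integral_density _ _ _ _ mu (exponential_pdf 1))//; last 3 first.
- exact: measurable_exponential_pdf.
- by move=> x; exact: exponential_pdf_ge0.
- by move=> A mA; rewrite /= /law_on setIT; exact: expX.
transitivity (\int[mu]_(x in `[0%R, +oo[) ((expR (- x))%:E * h x)).
  rewrite [RHS]integral_mkcond; apply: eq_integral => x _; rewrite patchE.
  rewrite /exponential_pdf patchE.
  by case: ifP => _; rewrite ?mul0e// mul1r mulN1r.
rewrite -integral_itv_obnd_cbnd; last first.
  by apply: measurable_funTS; meas.
rewrite integral_mkcond; apply: eq_integral => x _; rewrite patchE /exp1_pdf.
have -> : (x \in `]0%R, +oo[%classic) = (0 < x)%R.
  by apply/idP/idP; rewrite inE/= in_itv/= andbT.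
by case: ifP => _; rewrite ?mul0e.
Qed.

End laws.

Section combine.
Context d (T : measurableType d) (R : realType) (P : probability T R).
Context (E U : nat -> {RV P >-> R}).
Hypotheses (indepE : mutually_independent_RVs E)
  (indepU : mutually_independent_RVs U) (indepEU : independent_families E U).
Local Open Scope ereal_scope.

Definition both_families (i : nat + nat) : {RV P >-> R} :=
  match i with inl k => E k | inr k => U k end.

Lemma sigma_RVs_cylinder (X : nat -> {RV P >-> R}) (J : {fset nat})
    (B : nat -> set R) : (forall i, measurable (B i)) ->
  sigma_RVs X (cylinder X J B).
Proof.
move=> mB; pose G := \bigcup_i preimage_set_system setT (X i) measurable.
apply: (@fin_bigcap_measurable _ (g_sigma_algebraType G)).
  exact: finite_fset.
move=> i _; apply: sub_sigma_algebra; exists i => //.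
by exists (B i) => //; rewrite setTI.
Qed.

(** A finite block of indices splits into its two sides; the hypothesis on the
    pair of families separates the two events, and each is then a product. *)
Lemma mutually_independent_both_families : mutually_independent_RVs both_families.
Proof.
move=> J B mB.
pose getl (i : nat + nat) := if i is inl k then Some k else None.
pose getr (i : nat + nat) := if i is inr k then Some k else None.
pose sl := pmap getl J; pose sr := pmap getr J.
pose JE := [fset k in sl]%fset; pose JU := [fset k in sr]%fset.
have memE k : (k \in JE) = (inl k \in J).
  rewrite inE /=; apply/idP/idP.
    by rewrite mem_pmap => /mapP[[j|j] //= jJ [->]].
  by move=> kJ; rewrite mem_pmap; apply/mapP; exists (inl k).
have memU k : (k \in JU) = (inr k \in J).
  rewrite inE /=; apply/idP/idP.
    by rewrite mem_pmap => /mapP[[j|j] //= jJ [->]].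
  by move=> kJ; rewrite mem_pmap; apply/mapP; exists (inr k).
have usl : uniq sl.
  by apply: (@pmap_uniq _ _ _ inl) (fset_uniq J); case.
have usr : uniq sr.
  by apply: (@pmap_uniq _ _ _ inr) (fset_uniq J); case.
have -> : \bigcap_(i in [set` J]) both_families i @^-1` B i =
    cylinder E JE (B \o inl) `&` cylinder U JU (B \o inr).
  apply/seteqP; split => [w Jw|w [JEw JUw] [k|k] /= kJ].
  - by split => k /=; rewrite ?memE ?memU => /Jw.
  - by apply: JEw; rewrite /= memE.
  - by apply: JUw; rewrite /= memU.
have mBl k : measurable ((B \o inl) k) by exact: mB.
have mBr k : measurable ((B \o inr) k) by exact: mB.
rewrite indepEU; [|exact: sigma_RVs_cylinder|exact: sigma_RVs_cylinder].
rewrite (indepE _ mBl) (indepU _ mBr).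
have -> : \prod_(i <- JE) P (E i @^-1` (B \o inl) i) =
    \prod_(i <- sl) P (E i @^-1` B (inl i)).
  apply: perm_big; apply: uniq_perm => // k.
  by rewrite memE -memE inE.
have -> : \prod_(i <- JU) P (U i @^-1` (B \o inr) i) =
    \prod_(i <- sr) P (U i @^-1` B (inr i)).
  apply: perm_big; apply: uniq_perm => // k.
  by rewrite memU -memU inE.
rewrite /sl /sr; elim: (enum_fset J) => [|[k|k] s IHs] /=.
- by rewrite !big_nil mule1.
- by rewrite !big_cons -IHs muleA.
- by rewrite !big_cons -IHs muleCA.
Qed.

End combine.

(** * The chain (S_n, V_n) *)

Section chain.
Context d (T : measurableType d) (R : realType) (P : probability T R).
Context (E U : nat -> {RV P >-> R}).
Hypotheses (indepE : mutually_independent_RVs E)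
  (indepU : mutually_independent_RVs U) (indepEU : independent_families E U)
  (expE : forall k, exponentially_distributed 1 (E k))
  (unifU : forall k, uniformly_distributed ltr01 (U k)).
Local Notation mu := (@lebesgue_measure R).
Local Notation mR := (measurableTypeR R).
Local Notation Y := (both_families E U).
Let indepY := mutually_independent_both_families indepE indepU indepEU.

(** The map e selects the exponential variables in the order of their use, so
    that the same chain serves both S_n and S'_n. *)
Definition state (e : nat -> nat) (n : nat) (w : T) : mR * mR :=
  (\sum_(k < n) E (e k) w / \prod_(j < k.+1) U j w, \prod_(j < n) U j w).

Definition next_state (x : (mR * mR) * mR * mR) : mR * mR :=
  (x.1.1.1 + x.2 / (x.1.1.2 * x.1.2), x.1.1.2 * x.1.2).

Lemma measurable_next_state : measurable_fun setT next_state.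
Proof. by rewrite /next_state; meas. Qed.

Lemma stateS e n w : state e n.+1 w = next_state (state e n w, U n w, E (e n) w).
Proof. by rewrite /state /next_state /= !big_ord_recr. Qed.

Definition used_inputs (e : nat -> nat) n : set (nat + nat) := fun i =>
  match i with inl k => exists2 j, (j < n)%N & k = e j | inr k => (k < n)%N end.

Lemma independent_state e n : injective e ->
  independent_outside Y (used_inputs e n) (state e n).
Proof.
move=> e_inj; elim: n => [|n IHn].
  have -> : state e 0 = fun=> (0, 1).
    by apply/funext => w; rewrite /state !big_ord0.
  exact: independent_outside_cst.
have -> : state e n.+1 =
    next_state \o (fun w => (state e n w, U n w : mR, E (e n) w : mR)).
  by apply/funext => w; exact: stateS.
apply: (independent_outside_comp measurable_next_state).
have nU : ~ used_inputs e n (inr n) by rewrite /used_inputs ltnn.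
have := independent_outside_pair indepY IHn nU.
set D := [set j | _] => /= iXU.
have nE : ~ D (inl (e n)).
  by move=> [[j jn /e_inj nj]|//]; rewrite -nj ltnn in jn.
apply: independent_outside_sub (independent_outside_pair indepY iXU nE).
move=> [k|k] [[]|]//=.
- by move=> [j jn ->]; exists j => //; exact: leqW.
- by move=> [->]; exists n.
- by move=> kn; exact: leqW.
- by move=> [->].
Qed.

Lemma integral_stateS e n (phi : mR * mR -> \bar R) : injective e ->
  measurable_fun setT phi -> (forall x, 0 <= phi x)%E ->
  (\int[P]_w phi (state e n.+1 w) = \int[P]_w advance phi (state e n w))%E.
Proof.
move=> e_inj mphi phi0.
have iX := @independent_state e n e_inj.
have nU : ~ used_inputs e n (inr n) by rewrite /used_inputs ltnn.
have iXU := independent_outside_pair indepY iX nU.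
have nE : ~ [set j | used_inputs e n j \/ j = inr n] (inl (e n)).
  by move=> [[j jn /e_inj nj]|//]; rewrite -nj ltnn in jn.
have mexpo := @measurable_exp1_pdf R.
pose psi (x : mR * mR * mR) : \bar R :=
  (\int[mu]_e ((exp1_pdf e)%:E * phi (next_state (x, e))))%E.
have mpsi : measurable_fun setT psi.
  apply: meas_integral; last by move=> x y; rewrite weighted_ge0 ?exp1_pdf_ge0.
  by rewrite /next_state; meas.
have psi0 x : (0 <= psi x)%E.
  by apply: integral_ge0 => y _; rewrite weighted_ge0 ?exp1_pdf_ge0.
under eq_integral do rewrite stateS.
rewrite (integral_independent iXU nE (h := phi \o next_state))//=; last first.
  exact: measurableT_comp measurable_next_state.
transitivity (\int[P]_w psi (state e n w, U n w))%E.
  apply: eq_integral => w _.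
  have mh : measurable_fun setT
      (fun y : mR => phi (next_state (state e n w, U n w : mR, y))).
    by rewrite /next_state; meas.
  exact: (integral_exponential_RV (expE (e n)) mh (fun y => phi0 _)).
rewrite (integral_independent iX nU (h := psi))//.
apply: eq_integral => w _.
have mh : measurable_fun setT (fun u : mR => psi (state e n w, u)) by meas.
exact: (integral_uniform_RV (unifU n) mh (fun u => psi0 _)).
Qed.

Lemma integral_state0 e (phi : mR * mR -> \bar R) :
  (\int[P]_w phi (state e 0 w) = phi (0, 1)%R)%E.
Proof.
under eq_integral do rewrite /state !big_ord0.
by rewrite integral_cst//= probability_setT mule1.
Qed.

(** The induction is on all pairs phi, psi with the same conditional means:
    [advance] keeps this relation, and after the first step the expectations
    are integrals of these means. *)
Lemma integral_state_congr e e' n (phi psi : mR * mR -> \bar R) :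
  injective e -> injective e' ->
  measurable_fun setT phi -> (forall x, 0 <= phi x)%E ->
  measurable_fun setT psi -> (forall x, 0 <= psi x)%E ->
  (forall z, 0 < z -> cond_mean phi z = cond_mean psi z) ->
  (\int[P]_w phi (state e n.+1 w) = \int[P]_w psi (state e' n.+1 w))%E.
Proof.
move=> e_inj e'_inj; elim: n phi psi => [|n IHn] phi psi mphi phi0 mpsi psi0 h.
  rewrite (integral_stateS 0 e_inj mphi phi0) (integral_stateS 0 e'_inj mpsi psi0).
  rewrite !integral_state0 (advance_start mphi phi0) (advance_start mpsi psi0).
  apply: eq_integral => z _; case: ifP => [z0|_]; last by rewrite !mul0e.
  by rewrite (h _ z0).
rewrite (integral_stateS n.+1 e_inj mphi phi0).
rewrite (integral_stateS n.+1 e'_inj mpsi psi0); apply: IHn.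
- exact: measurable_advance.
- by move=> x; exact: advance_ge0.
- exact: measurable_advance.
- by move=> x; exact: advance_ge0.
- by move=> z z0; exact: eq_cond_mean_advance.
Qed.

Lemma integral_lhs_mean e n (f : mR -> \bar R) : injective e ->
  measurable_fun setT f -> (forall x, 0 <= f x)%E ->
  (\int[P]_w lhs_mean f (state e n w) =
   \int[P]_w f ((state e n w).1 * (1 - (state e n w).2 * U n w))%R)%E.
Proof.
move=> e_inj mf f0; have iX := @independent_state e n e_inj.
have nU : ~ used_inputs e n (inr n) by rewrite /used_inputs ltnn.
rewrite (integral_independent iX nU
  (h := fun x => f (x.1.1 * (1 - x.1.2 * x.2))%R))//; last by meas.
apply: eq_integral => w _.
have mh : measurable_fun setT
  (fun u : mR => f ((state e n w).1 * (1 - (state e n w).2 * u))%R) by meas.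
exact/esym/(integral_uniform_RV (unifU n) mh (fun u => f0 _)).
Qed.

Lemma integral_rhs_mean e n k (f : mR -> \bar R) : injective e ->
  (forall j, (j < n)%N -> e j != k) ->
  measurable_fun setT f -> (forall x, 0 <= f x)%E ->
  (\int[P]_w rhs_mean f (state e n w) =
   \int[P]_w f (((state e n w).1 + E k w) * (1 - (state e n w).2))%R)%E.
Proof.
move=> e_inj ek mf f0; have iX := @independent_state e n e_inj.
have nE : ~ used_inputs e n (inl k).
  by move=> [j jn kj]; have := ek _ jn; rewrite kj eqxx.
rewrite (integral_independent iX nE
  (h := fun x => f ((x.1.1 + x.2) * (1 - x.1.2))%R))//; last by meas.
apply: eq_integral => w _.
have mh : measurable_fun setT
  (fun y : mR => f (((state e n w).1 + y) * (1 - (state e n w).2))%R) by meas.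
exact/esym/(integral_exponential_RV (expE k) mh (fun y => f0 _)).
Qed.

End chain.

(* E k and U k stand for the (k+1)-st terms of the two sequences.  Some U k may
   vanish, or leave [0, 1], on a null event; there x / 0 is the library's 0. *)
Theorem mainTheorem2 (R : realType) (d : measure_display)
    (T : measurableType d) (P : probability T R)
    (E U : nat -> {RV P >-> R})
    (indepE : mutually_independent_RVs E)
    (indepU : mutually_independent_RVs U)
    (indepEU : independent_families E U)
    (expE : forall k, exponentially_distributed 1 (E k))
    (unifU : forall k, uniformly_distributed ltr01 (U k))
    (n : nat) (n_gt0 : (0 < n)%N) :
  eq_in_distribution P
    (fun w => (\sum_(k < n) E k w / \prod_(j < k.+1) U j w)
              * (1 - \prod_(j < n.+1) U j w))
    (fun w => (\sum_(k < n.+1) E k w / \prod_(j < k) U j w)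
              * (1 - \prod_(j < n) U j w)).
Proof.
case: n n_gt0 => [//|n] _.
pose mR := measurableTypeR R.
pose sE := state E U.
have mstate e : injective e -> measurable_fun setT (sE e n.+1).
  by move=> e_inj; case: (independent_state indepE indepU indepEU n.+1 e_inj).
have mU : measurable_fun setT (U n.+1 : T -> mR)
  by exact: (@measurable_funPT _ _ _ _ (U n.+1)).
have mE : measurable_fun setT (E 0%N : T -> mR)
  by exact: (@measurable_funPT _ _ _ _ (E 0%N)).
have inj_id : injective (@id nat) by [].
have ms_id := mstate _ inj_id; have ms_S := mstate _ succn_inj.
(* The left-hand side uses the exponentials in their order and the next uniform
   variable; the right-hand side keeps E 0 aside and feeds the chain with
   E 1, E 2, ... *)
pose X w : mR := (sE id n.+1 w).1 * (1 - (sE id n.+1 w).2 * U n.+1 w).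
pose Z w : mR := ((sE succn n.+1 w).1 + E 0%N w) * (1 - (sE succn n.+1 w).2).
have -> : (fun w => (\sum_(k < n.+1) E k w / \prod_(j < k.+1) U j w)
              * (1 - \prod_(j < n.+2) U j w)) = X.
  by apply/funext => w; congr (_ * (1 - _)); exact: big_ord_recr.
have -> : (fun w => (\sum_(k < n.+2) E k w / \prod_(j < k) U j w)
              * (1 - \prod_(j < n.+1) U j w)) = Z.
  apply/funext => w; congr (_ * _).
  by rewrite big_ord_recl big_ord0 divr1 addrC.
have mX : measurable_fun setT X by rewrite /X; meas.
have mZ : measurable_fun setT Z by rewrite /Z; meas.
split; [exact: mX|exact: mZ|move=> A mA].
pose f (x : mR) : \bar R := (\1_(A : set mR) x)%:E.
have mf : measurable_fun setT f by apply/measurable_EFinP; exact: measurable_indic.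
have f0 x : (0 <= f x)%E by rewrite lee_fin.
have fE (W : T -> mR) : measurable_fun setT W ->
    pushforward P W A = (\int[P]_w f (W w))%E.
  move=> mW; rewrite /f (_ : (fun _ => _) = (EFin \o \1_(W @^-1` A)))//.
  by rewrite integral_indic// ?setIT// -[_ @^-1` _]setTI; exact: mW.
transitivity (\int[P]_w f (X w))%E; first exact: fE.
transitivity (\int[P]_w f (Z w))%E; last by apply/esym; exact: fE.
transitivity (\int[P]_w lhs_mean f (sE id n.+1 w))%E.
  exact/esym/(integral_lhs_mean indepE indepU indepEU unifU n.+1 inj_id mf f0).
transitivity (\int[P]_w rhs_mean f (sE succn n.+1 w))%E.
  apply: (integral_state_congr indepE indepU indepEU expE unifU n
    inj_id succn_inj).
  - exact: measurable_lhs_mean.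
  - by move=> x; exact: lhs_mean_ge0.
  - exact: measurable_rhs_mean.
  - by move=> x; exact: rhs_mean_ge0.
  - by move=> z; exact: eq_cond_mean_lhs_rhs.
exact: (integral_rhs_mean (k := 0%N) indepE indepU indepEU expE succn_inj).
Qed.
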